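(* In the single energy arrival problem, let $P(t)$ be the optimal policy and $T(t)$ the resulting temperature. Let $t'=\min\{t\in[0,D]: T(t)=T_c\}$. If $t'$ exists and $t'<D$, then $P(t)=\frac{T_\delta b}{a}$ for all $t\in[t',D]$.
   Context: Single energy arrival problem: fix a deadline $D>0$, an available energy $E>0$, constants $a,b>0$, an environment temperature $T_e$ and a critical temperature $T_c>T_e$; set $T_\delta=T_c-T_e$. A power policy is a measurable function $P:[0,D]\to[0,\infty)$. The resulting temperature $T(t)$ solves $\frac{d}{dt}T(t)=aP(t)-b(T(t)-T_e)$, $T(0)=T_e$, i.e. $T(t)=T_e+e^{-bt}\int_0^t ae^{b\tau}P(\tau)\,d\tau$. The optimal policy is the maximizer of $\int_0^D\frac12\log_2(1+P(\tau))\,d\tau$ over power policies satisfying $T(t)\le T_c$ for all $t\in[0,D]$ and $\int_0^DP(\tau)\,d\tau\le E$. It is unique almost everywhere; pointwise statements about it are understood after modification on a null set. *)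

(* Defs.v *)
From mathcomp Require Import all_boot all_order all_algebra.
From mathcomp Require Import all_classical all_reals all_analysis.

Set Implicit Arguments.
Unset Strict Implicit.
Unset Printing Implicit Defensive.

Import Order.TTheory GRing.Theory Num.Theory.
Import numFieldNormedType.Exports.

Local Open Scope classical_set_scope.
Local Open Scope ring_scope.

(* A policy is a total function P : R -> R of which only the values on [0, D]
   are ever used. *)

Definition log2 (R : realType) (x : R) : R := ln x / ln 2.

Definition power_policy (R : realType) (D : R) (P : R -> R) : Prop :=
  measurable_fun `[0, D] P /\ (forall t, t \in `[0, D] -> 0 <= P t).

(* Variation-of-constants solution of T' = a P - b (T - Te), T(0) = Te.
   Rintegral is 0 by convention when the integral is infinite; this never
   happens for t in [0, D] and a policy of finite energy. *)
Definition temperature (R : realType) (a b Te : R) (P : R -> R) (t : R) : R :=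
  Te + expR (- (b * t)) *
       Rintegral lebesgue_measure `[0, t] (fun tau => a * expR (b * tau) * P tau).

Definition energy (R : realType) (D : R) (P : R -> R) : \bar R :=
  (\int[lebesgue_measure]_(tau in `[0%R, D]) (P tau)%:E)%E.

Definition throughput (R : realType) (D : R) (P : R -> R) : \bar R :=
  (\int[lebesgue_measure]_(tau in `[0%R, D]) (2^-1 * log2 (1 + P tau))%:E)%E.

Definition feasible (R : realType) (D E a b Te Tc : R) (P : R -> R) : Prop :=
  [/\ power_policy D P,
      forall t, t \in `[0, D] -> temperature a b Te P t <= Tc
    & (energy D P <= E%:E)%E].

(* Maximizers are only determined up to a null set, so this is a predicate on
   representatives. *)
Definition optimal_policy (R : realType) (D E a b Te Tc : R) (P : R -> R) :
    Prop :=
  feasible D E a b Te Tc P /\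
  (forall Q : R -> R, feasible D E a b Te Tc Q ->
     (throughput D Q <= throughput D P)%E).

Definition is_min (R : realType) (A : set R) (m : R) : Prop :=
  A m /\ lbound A m.

(* Main.v *)
(* Let c = (Tc - Te) b / a be the power that holds the temperature at Tc.
   Integrating by layer cake the bound that the temperature constraint puts on
   the heat received since t', the energy that P spends on [t', D] falls short of
   c (D - t') by some d >= 0. As the temperature climbs from Te to Tc on [0, t'],
   the energy m spent there in excess of c is positive. Hence P can be moved
   towards c by a positive factor on all of [t', D], paid for by moving it towards
   c on the part of [0, t'[ where P > c, with the total energy unchanged; the new
   policy is still feasible. But moving towards c increases
   ln (1 + x) - x / (1 + c) strictly, so P = c almost everywhere on [t', D]. *)

Require Import Defs.
From mathcomp Require Import all_boot all_order all_algebra.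
From mathcomp Require Import all_classical all_reals all_analysis.
From mathcomp Require Import measurable_realfun ring lra.
Import Order.TTheory GRing.Theory Num.Theory.
Import numFieldNormedType.Exports.
Local Open Scope classical_set_scope.
Local Open Scope ring_scope.

(** * Layer cake and the comparison of weighted integrals *)

(** Tonelli for the function equal to [u x] on the region [0 <= y <= g x]: integrating in [y] first
    gives the length [g x], integrating in [x] first gives the superlevel sets of [g]. *)
Lemma integral_layer_cake d (T : measurableType d) (R : realType)
    (mu : {sigma_finite_measure set T -> \bar R}) (I : set T) (g u : T -> R) :
  measurable I -> measurable_fun I g -> measurable_fun I u ->
  (forall x, I x -> 0 <= g x) -> (forall x, I x -> 0 <= u x) ->
  (\int[mu]_(x in I) (g x * u x)%:E =
   \int[lebesgue_measure]_(y in `[0%R, +oo[)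
     \int[mu]_(x in I `&` [set x | (y <= g x)%R]) (u x)%:E)%E.
Proof.
move=> mI mg mu_ g0 u0.
have mg' : measurable_fun setT (g \_ I) by apply/(measurable_restrictT _ mI).
have mu' : measurable_fun setT (u \_ I) by apply/(measurable_restrictT _ mI).
have g'0 x : 0 <= (g \_ I) x by rewrite patchE; case: ifPn => // /set_mem/g0.
have u'0 x : 0 <= (u \_ I) x by rewrite patchE; case: ifPn => // /set_mem/u0.
(* The region under the graph of [g], with [g] and [u] extended by 0 outside [I] so that the whole
   product space can be used. *)
pose A := [set p : T * R | (0 <= p.2) && (p.2 <= (g \_ I) p.1)].
have mA : measurable A.
  have : measurable_fun setT
      (fun p : T * R => (0 <= p.2) && (p.2 <= (g \_ I) p.1)).
    apply: measurable_and; apply: measurable_fun_ler => //.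
    exact: measurableT_comp.
  by move=> /(_ measurableT [set true]); rewrite setTI; exact.
pose f p := ((u \_ I) p.1 * \1_A p)%:E.
have mf : measurable_fun setT f.
  apply/measurable_EFinP/measurable_funM; first exact: measurableT_comp.
  exact: measurable_indic.
have f0 p : (0 <= f p)%E by rewrite lee_fin mulr_ge0.
transitivity (\int[mu]_x \int[lebesgue_measure]_y f (x, y))%E.
  rewrite integral_mkcond; apply: eq_integral => x _.
  transitivity ((u \_ I) x * (g \_ I) x)%:E.
    by rewrite !patchE; case: ifPn; rewrite ?mulr0// mulrC.
  under eq_integral => y _.
    rewrite /f/= (_ : \1_A _ = \1_(`[0, (g \_ I) x]) y); last first.
      by rewrite !indicE/=; congr (nat_of_bool _)%:R;
        apply: asbool_equiv_eq; rewrite /A/= in_itv.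
    rewrite EFinM.
    over.
  rewrite ge0_integralZl//=; last 2 first.
  - exact/measurable_EFinP/measurable_indic.
  - by rewrite lee_fin.
  rewrite integral_indic// setIT EFinM; congr (_ * _)%E; apply/esym.
  apply: etrans (lebesgue_measure_itv `[0, (g \_ I) x]) _; rewrite /= lte_fin.
  case: ltP => [|g0']; first by rewrite sube0.
  by congr EFin; apply/le_anti; rewrite g0' g'0.
apply: etrans (@fubini_tonelli _ _ _ _ R mu lebesgue_measure f mf f0) _.
rewrite [RHS]integral_mkcond.
(* For negative [y] the slice of [A] is empty; for the others it meets [I] in the superlevel set. *)
apply: eq_integral => y _; rewrite patchE; case: ifPn => y0; last first.
  rewrite integral0_eq// => x _; rewrite /f indicE memNset ?mulr0//=.
  by move: y0; rewrite notin_setE/= in_itv/= andbT => + /andP[].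
rewrite [RHS]integral_mkcond; apply: eq_integral => x _.
rewrite /f !patchE/= indicE in_setI; have [xI|_] := boolP (x \in I); last first.
  by rewrite mul0r.
have -> : ((x, y) \in A) = (x \in [set x | y <= g x]).
  apply: asbool_equiv_eq; rewrite /A/= patchE xI.
  by move: y0; rewrite inE/= in_itv/= andbT => ->.
by rewrite /=; case: ifPn => _; rewrite ?mulr1 ?mulr0.
Qed.

(** The integral of a nonnegative function is a supremum over the simple functions below it, and a
    larger function has more of these. This spares a proof that the integrals over superlevel sets
    are measurable in the level. *)
Lemma ge0_le_integral_nonmeasurable d (T : measurableType d) (R : realType)
    (mu : {measure set T -> \bar R}) (D : set T) (f g : T -> \bar R) :
  (forall x, D x -> 0 <= f x)%E -> (forall x, D x -> f x <= g x)%E ->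
  (\int[mu]_(x in D) f x <= \int[mu]_(x in D) g x)%E.
Proof.
move=> f0 fg; have g0 x (Dx : D x) := le_trans (f0 x Dx) (fg x Dx).
rewrite !(integral_mkcond D) !ge0_integralTE; last 2 first.
- by move=> x; exact: erestrict_ge0.
- by move=> x; exact: erestrict_ge0.
apply: le_ereal_sup => _ [h hf <-]; exists h => // x.
by apply: le_trans (hf x) _; exact: lee_restrict.
Qed.

(** By layer cake it suffices to compare the integrals of [u] and [v] over each superlevel set of
    [g]. Since [g] is nonincreasing, these sets are initial segments of the interval, where the last
    hypothesis applies. *)
Lemma ge0_le_integral_weighted (R : realType) (x y : R) (g u v : R -> R) :
  measurable_fun `[x, y] g -> measurable_fun `[x, y] u ->
  measurable_fun `[x, y] v ->
  {in `[x, y], forall s, 0 <= g s} -> {in `[x, y], forall s, 0 <= u s} ->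
  {in `[x, y], forall s, 0 <= v s} ->
  {in `[x, y] &, {homo g : s t /~ s <= t}} ->
  (forall s, s \in `[x, y] ->
    \int[lebesgue_measure]_(t in `[x, s]) (u t)%:E <=
    \int[lebesgue_measure]_(t in `[x, s]) (v t)%:E)%E ->
  (\int[lebesgue_measure]_(t in `[x, y]) (g t * u t)%:E <=
   \int[lebesgue_measure]_(t in `[x, y]) (g t * v t)%:E)%E.
Proof.
move=> mg mu_ mv g0 u0 v0 g_anti uv.
rewrite !integral_layer_cake//.
apply: ge0_le_integral_nonmeasurable => [l _|l _].
  by apply: integral_ge0 => t [/u0]; rewrite lee_fin.
set A := `[x, y] `&` [set t | l <= g t].
have mA : measurable A.
  rewrite /A (_ : [set t | _] = g @^-1` `[l, +oo[) ?preimage_itvcy//.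
  by rewrite -preimage_itvcy; exact: mg.
(* A superlevel set of [g] is empty, [[x, s]] or [[x, s[]. *)
have [->|/set0P[a Aa]] := eqVneq A set0; first by rewrite !integral_set0.
have Ale : ubound A y by move=> t [/=]; rewrite in_itv/= => /andP[].
have supA : has_sup A by split; [exists a|exists y].
have s_xy : sup A \in `[x, y].
  have [+ _] := Aa; rewrite /= !in_itv/= => /andP[xa _].
  rewrite (le_trans xa (ub_le_sup supA.2 Aa))/=; exact: (ge_sup supA.1 Ale).
have /andP[xs sy] : x <= sup A <= y by move: s_xy; rewrite in_itv.
have sub1 : A `<=` `[x, sup A].
  move=> t At; have [+ _] := At; rewrite /= !in_itv/= => /andP[-> _]/=.
  exact: (ub_le_sup supA.2 At).
have sub2 : `[x, sup A[ `<=` A.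
  move=> t /=; rewrite in_itv/= => /andP[xt ts].
  have [r Ar tr] := sup_gt supA.1 ts.
  have txy : t \in `[x, y] by rewrite in_itv/= xt (le_trans (ltW ts)).
  split => //=; have [rxy /le_trans] := Ar; apply.
  by apply: g_anti => //; exact: ltW.
have sub3 : `[x, sup A] `<=` `[x, y] by apply: subset_itvl; rewrite bnd_simp.
have mon f : measurable_fun `[x, y] f -> measurable_fun `[x, sup A] (EFin \o f).
  by move=> mf; apply/measurable_EFinP; apply: (measurable_funS _ _ mf).
(* [A] lies between [[x, sup A[] and [[x, sup A]]. For [u] it is enlarged to the closed interval,
   for [v] it is shrunk to the half-open one; the endpoint is a null set. *)
apply: (@le_trans _ _ (\int[lebesgue_measure]_(t in `[x, sup A]) (u t)%:E)%E).
  apply: ge0_subset_integral => //; first exact: mon.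
  by move=> t /sub3/u0; rewrite lee_fin.
apply: le_trans (uv _ s_xy) _.
rewrite -integral_itv_bndo_bndc; last first.
  apply/measurable_EFinP; apply: (measurable_funS _ _ mv) => //.
  by apply: subset_itvl; rewrite bnd_simp.
apply: ge0_subset_integral => //.
  by apply/measurable_EFinP; apply: (measurable_funS _ _ mv) => // t [].
by move=> t [/v0]; rewrite lee_fin.
Qed.

(** * A strict inequality for the logarithm *)

(** Since [y] differs from [x], ln x - ln y < (x - y) / y. As [y] lies between [x] and [k], the
    right-hand side is at most (x - y) / k. *)
Lemma ltr_ln_sub_tangent (R : realType) (k x w : R) :
  0 < k -> 0 < x -> x != k -> 0 < w <= 1 ->
  let y := x + w * (k - x) in ln x - x / k < ln y - y / k.
Proof.
move=> k0 x0 xk /andP[w0 w1]; set y := x + w * (k - x); move=> /=.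
have y0 : 0 < y by rewrite /y; nra.
have yx : x / y - 1 != 0.
  rewrite subr_eq0; apply: contra_neq xk => xy1.
  have {}xy1 : x = y by rewrite -(divfK (lt0r_neq0 y0) x) xy1 mul1r.
  have /eqP : w * (k - x) = 0 by rewrite /y in xy1; lra.
  by rewrite mulf_eq0 (gt_eqF w0)/= subr_eq0 => /eqP.
have /lt_le_trans : ln x - ln y < x / y - 1.
  rewrite -ln_div ?posrE// -ltr_expR lnK ?posrE ?divr_gt0//.
  by have := expR_gt1Dx yx; rewrite addrC subrK.
have : 0 <= (y - x) / y - (y - x) / k.
  have -> : (y - x) / y - (y - x) / k = w * (1 - w) * (k - x) ^+ 2 / (y * k).
    by rewrite /y; field; rewrite !gt_eqF.
  apply: divr_ge0; last by rewrite mulr_ge0// ltW.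
  by rewrite mulr_ge0 ?sqr_ge0// mulr_ge0 ?subr_ge0// ltW.
rewrite !mulrBl divff ?gt_eqF// => h /(_ (x / k - y / k)) lt.
have {}lt : ln x - ln y < x / k - y / k by apply: lt; lra.
lra.
Qed.

(** * Integrals with an exponential weight *)

Lemma Rintegral_expR (R : realType) (b s t : R) : b != 0 -> s <= t ->
  Rintegral lebesgue_measure `[s, t] (fun x => expR (b * x)) =
  (expR (b * t) - expR (b * s)) / b.
Proof.
move=> b0; rewrite le_eqVlt => /predU1P[->|st].
  by rewrite set_itv1 Rintegral_set1 subrr mul0r.
pose F (x : R) : R := b^-1 * expR (b * x).
have dF x : is_derive (x : R) (1 : R) F (expR (b * x)).
  have db : is_derive (x : R) (1 : R) (fun z : R => b * z) b.
    by apply: is_derive_eq (is_deriveZ b (is_derive_id x 1)) _; rewrite scaler1.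
  have dexp := is_derive1_comp (is_derive_expR (b * x)) db.
  by apply: is_derive_eq (is_deriveZ b^-1 dexp) _; rewrite mulrC [LHS]mulKf.
have cF : continuous F.
  move=> x; apply: differentiable_continuous; apply/derivable1_diffP.
  exact: ex_derive.
rewrite /Rintegral (@continuous_FTC2 _ _ F)//.
- by rewrite /F /= -mulrBr mulrC.
- apply: continuous_subspaceT => x.
  by apply: continuous_comp; [exact: mulrl_continuous|exact: continuous_expR].
- split => //.
  + by apply: cvg_at_right_filter; exact: cF.
  + by apply: cvg_at_left_filter; exact: cF.
- by move=> x _; rewrite derive1E; exact: derive_val.
Qed.

Lemma integrable_expR_mul (R : realType) (b x y : R) (P : R -> R) :
  0 <= b ->
  lebesgue_measure.-integrable `[x, y] (EFin \o P) ->
  lebesgue_measure.-integrable `[x, y] (EFin \o (fun t => expR (b * t) * P t)).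
Proof.
move=> b0 iP; apply: le_integrable (integrableZl _ (expR (b * y)) iP) => //.
  apply/measurable_EFinP/measurable_funM.
    by apply: measurable_funTS; apply: measurableT_comp.
  by apply/measurable_EFinP; exact: measurable_int iP.
move=> t /=; rewrite in_itv/= => /andP[_ ty].
rewrite lee_fin !normrM ler_wpM2r// !ger0_norm ?expR_ge0// ler_expR.
exact: ler_wpM2l.
Qed.

Lemma Rintegral_itv_cat (R : realType) (x y z : R) (f : R -> R) :
  x <= y <= z -> lebesgue_measure.-integrable `[x, z] (EFin \o f) ->
  Rintegral lebesgue_measure `[x, z] f =
  Rintegral lebesgue_measure `[x, y] f + Rintegral lebesgue_measure `[y, z] f.
Proof.
move=> /andP[xy yz] fi.
rewrite -(@Rintegral_itv_obnd_cbnd _ y); last first.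
  by apply: integrableS fi => //; apply: subset_itvr; rewrite bnd_simp.
by rewrite -(@Rintegral_itvB _ f (BLeft x))// addrC subrK.
Qed.

(** This turns a comparison of accumulated heat into a comparison of energy. The nonincreasing
    weight [expR (- b * t)] cancels the factor [expR (b * t)], and [ge0_le_integral_weighted]
    applies. *)
Lemma le_Rintegral_of_expR_mul (R : realType) (b x y : R) (P Q : R -> R) :
  0 <= b ->
  lebesgue_measure.-integrable `[x, y] (EFin \o P) ->
  lebesgue_measure.-integrable `[x, y] (EFin \o Q) ->
  {in `[x, y], forall t, 0 <= P t} -> {in `[x, y], forall t, 0 <= Q t} ->
  {in `[x, y], forall s,
    Rintegral lebesgue_measure `[x, s] (fun t => expR (b * t) * P t) <=
    Rintegral lebesgue_measure `[x, s] (fun t => expR (b * t) * Q t)} ->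
  Rintegral lebesgue_measure `[x, y] P <= Rintegral lebesgue_measure `[x, y] Q.
Proof.
move=> b0 iP iQ P0 Q0 PQ.
have mexp k : measurable_fun `[x, y] (fun t : R => expR (k * t)).
  by apply: measurable_funTS; apply: measurableT_comp.
have mP : measurable_fun `[x, y] P.
  by apply/measurable_EFinP; case/integrableP : iP.
have mQ : measurable_fun `[x, y] Q.
  by apply/measurable_EFinP; case/integrableP : iQ.
have cancel f t : f t = expR (- b * t) * (expR (b * t) * f t).
  by rewrite mulrA -expRD mulNr addNr expR0 mul1r.
apply: fine_le; [exact: integrable_fin_num|exact: integrable_fin_num|].
under eq_integral do rewrite (cancel P).
under [leRHS]eq_integral do rewrite (cancel Q).
apply: ge0_le_integral_weighted => //.
- exact: measurable_funM.
- exact: measurable_funM.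
- by move=> t /P0 ?; rewrite mulr_ge0 ?expR_ge0.
- by move=> t /Q0 ?; rewrite mulr_ge0 ?expR_ge0.
- by move=> s t _ _ st; rewrite ler_expR !mulNr lerN2 ler_wpM2l.
move=> s sxy; have sub : `[x, s] `<=` `[x, y].
  by apply: subset_itvl; rewrite bnd_simp; move: sxy; rewrite in_itv => /andP[].
have fin f : lebesgue_measure.-integrable `[x, y] (EFin \o f) ->
    (\int[lebesgue_measure]_(t in `[x, s]) (expR (b * t) * f t)%:E
      \is a fin_num)%E.
  move=> fi; apply: integrable_fin_num => //; apply: integrable_expR_mul => //.
  exact: integrableS fi.
by rewrite -(fineK (fin P iP)) -(fineK (fin Q iQ)) lee_fin; exact: PQ.
Qed.

(** * Integrability of policies and the consequence of optimality *)

Lemma integrable_ln1D d (T : measurableType d) (R : realType)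
    (mu : {measure set T -> \bar R}) (A : set T) (P : T -> R) :
  measurable A -> mu.-integrable A (EFin \o P) ->
  (forall x, A x -> 0 <= P x) ->
  mu.-integrable A (EFin \o (fun x => ln (1 + P x))).
Proof.
move=> mA iP P0; apply: (le_integrable mA _ _ iP) => //.
  apply/measurable_EFinP; apply: measurableT_comp => //.
  apply: measurable_funD => //; apply/measurable_EFinP.
  exact: measurable_int iP.
move=> x Ax; have Px := P0 x Ax; rewrite lee_fin !ger0_norm ?ln_ge0 ?lerDl//.
by apply: le_ln1Dx; lra.
Qed.

(** The energy budget is finite and the policy nonnegative. Hence the [Rintegral]s of a feasible
    policy are true integrals, not the default value 0. *)
Lemma feasible_integrable {R : realType} {D E a b Te Tc : R} {P : R -> R} :
  feasible D E a b Te Tc P -> lebesgue_measure.-integrable `[0, D] (EFin \o P).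
Proof.
move=> [[mP P0] _ PE]; apply/integrableP; split; first exact/measurable_EFinP.
apply: le_lt_trans (ltry E); apply: le_trans PE.
apply: ge0_le_integral_nonmeasurable => // t t0D.
by rewrite lee_fin ger0_norm//; exact: P0.
Qed.

Lemma temperatureE {R : realType} (a b Te t : R) (P : R -> R) : 0 <= b ->
  lebesgue_measure.-integrable `[0, t] (EFin \o P) ->
  temperature a b Te P t = Te + a * expR (- (b * t)) *
    Rintegral lebesgue_measure `[0, t] (fun s => expR (b * s) * P s).
Proof.
move=> b0 iP; rewrite /temperature; congr (_ + _).
under eq_Rintegral do rewrite -mulrA.
rewrite RintegralZl//; last exact: integrable_expR_mul.
by rewrite mulrA (mulrC a).
Qed.

Lemma throughputE (R : realType) (D : R) (P : R -> R) :
  lebesgue_measure.-integrable `[0, D] (EFin \o P) ->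
  {in `[0, D], forall t, 0 <= P t} ->
  throughput D P = (2^-1 / ln 2 *
    Rintegral lebesgue_measure `[0, D] (fun t => ln (1 + P t)))%:E.
Proof.
move=> iP P0.
have iln : lebesgue_measure.-integrable `[0, D] (EFin \o (fun t => ln (1 + P t))).
  exact: integrable_ln1D.
rewrite /throughput -RintegralZl// fineK; last first.
  by apply: integrable_fin_num => //; exact: integrableZl _ _ iln.
by apply: eq_integral => t _; rewrite /log2 mulrA mulrAC.
Qed.

(* The function [ln (1 + x) - x / (1 + c)] is maximal at [c] only, so moving [P]
   towards [c] at constant energy would raise the throughput. *)
Lemma optimal_policy_ae_eq (R : realType) (D E a b Te Tc c : R) (P Q w : R -> R) :
  0 <= c -> optimal_policy D E a b Te Tc P -> feasible D E a b Te Tc Q ->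
  {in `[0, D], forall t, 0 <= w t <= 1 /\ Q t = P t + w t * (c - P t)} ->
  Rintegral lebesgue_measure `[0, D] P <= Rintegral lebesgue_measure `[0, D] Q ->
  {ae lebesgue_measure, forall t, t \in `[0, D] -> 0 < w t -> P t = c}.
Proof.
move=> c0 [P_feas P_max] Q_feas Qw PQ.
have iP := feasible_integrable P_feas; have iQ := feasible_integrable Q_feas.
have [[_ P0] _ _] := P_feas; have [[_ Q0] _ _] := Q_feas.
(* The multiplier [(1 + c)^-1] is the derivative of ln (1 + x) at [c], so [phi] charges for energy
   at its marginal value there. [H] is the pointwise gain from [P] to [Q]. *)
pose phi (f : R -> R) t := ln (1 + f t) - (1 + c)^-1 * f t.
pose H t := phi Q t - phi P t.
have iln f : lebesgue_measure.-integrable `[0, D] (EFin \o f) ->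
    {in `[0, D], forall t, 0 <= f t} ->
    lebesgue_measure.-integrable `[0, D] (EFin \o (fun t => ln (1 + f t))).
  by move=> fi f0; exact: integrable_ln1D.
have icf f : lebesgue_measure.-integrable `[0, D] (EFin \o f) ->
    lebesgue_measure.-integrable `[0, D] (EFin \o (fun t => (1 + c)^-1 * f t)).
  by move=> fi; exact: integrableZl _ _ fi.
have iphi f : lebesgue_measure.-integrable `[0, D] (EFin \o f) ->
    {in `[0, D], forall t, 0 <= f t} ->
    lebesgue_measure.-integrable `[0, D] (EFin \o phi f).
  by move=> fi f0; apply: (integrableB _ (iln f fi f0) (icf f fi)).
have iH : lebesgue_measure.-integrable `[0, D] (EFin \o H).
  by apply: (integrableB _ (iphi Q iQ Q0) (iphi P iP P0)).
have Hgt t : t \in `[0, D] -> 0 < w t -> P t != c -> 0 < H t.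
  move=> t0D wt Ptc; have [/andP[_ w1] QE] := Qw t t0D.
  have k0 : 0 < 1 + c by rewrite ltr_wpDr.
  have x0 : 0 < 1 + P t by rewrite ltr_wpDr ?P0.
  have xk : 1 + P t != 1 + c by rewrite (inj_eq (addrI 1)).
  have /= := ltr_ln_sub_tangent R _ _ (w t) k0 x0 xk; rewrite wt w1.
  have -> : 1 + P t + w t * (1 + c - (1 + P t)) = 1 + Q t by rewrite QE; ring.
  by move=> /(_ isT); rewrite /H /phi; lra.
have Hge t : t \in `[0, D] -> 0 <= H t.
  move=> t0D; have [/andP[w0 _] QE] := Qw t t0D.
  have [QP|/eqP QP] := eqVneq (Q t) (P t); first by rewrite /H /phi QP subrr.
  apply/ltW/Hgt => //.
    rewrite lt_neqAle w0 andbT; apply: contra_not_neq QP => w0'.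
    by rewrite QE -w0' mul0r addr0.
  by apply: contra_not_neq QP => Ptc; rewrite QE Ptc subrr mulr0 addr0.
(* Optimality of [P] bounds the change of the logarithmic part by 0, and [Q] spends at least the
   energy of [P]. *)
have IH : Rintegral lebesgue_measure `[0, D] H <= 0.
  rewrite RintegralB//; [|exact: iphi|exact: iphi].
  rewrite !RintegralB//; [|exact: iln|exact: icf|exact: iln|exact: icf].
  rewrite !RintegralZl//.
  have := P_max _ Q_feas; rewrite !throughputE// lee_fin ler_pM2l; last first.
    by rewrite divr_gt0// ln_gt0// ltr1n.
  have : (1 + c)^-1 * Rintegral lebesgue_measure `[0, D] P <=
         (1 + c)^-1 * Rintegral lebesgue_measure `[0, D] Q.
    by rewrite ler_wpM2l// invr_ge0 addr_ge0.
  lra.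
(* A nonnegative [H] with integral at most 0 vanishes almost everywhere, whereas it is positive
   wherever [w] is positive and [P] differs from [c]. *)
have [+ _] := ae_eq_integral_abs lebesgue_measure
  (measurable_itv `[0, D]) (measurable_int _ iH).
have <- : (\int[lebesgue_measure]_(t in `[0%R, D]) (H t)%:E =
    \int[lebesgue_measure]_(t in `[0%R, D]) `|(EFin \o H) t|)%E.
  by apply: eq_integral => t /set_mem t0D; rewrite /= ger0_norm//; exact: Hge.
have -> : (\int[lebesgue_measure]_(t in `[0%R, D]) (H t)%:E = 0)%E.
  apply/eqP; rewrite eq_le integral_ge0 ?andbT; last exact: Hge.
  by rewrite -(fineK (integrable_fin_num _ iH))// lee_fin.
move=> /(_ erefl).
apply: filterS => t HE t0D wt; apply/eqP/contraT => Ptc.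
by have /eqP := HE t0D; rewrite eqe gt_eqF//; exact: Hgt.
Qed.

(** * The exchange of energy across the time [t'] *)

Theorem lemma13 (R : realType) (D E a b Te Tc : R)
    (D_gt0 : 0 < D) (E_gt0 : 0 < E) (a_gt0 : 0 < a) (b_gt0 : 0 < b)
    (Te_lt_Tc : Te < Tc)
    (P : R -> R) (P_opt : optimal_policy D E a b Te Tc P)
    (t' : R)
    (t'_min : is_min [set t | t \in `[0, D] /\ temperature a b Te P t = Tc] t')
    (t'_lt_D : t' < D) :
  {ae lebesgue_measure, forall t : R,
     t \in `[t', D] -> P t = (Tc - Te) * b / a}.
Proof.
set c := (Tc - Te) * b / a.
have [[t'0D Tt'] _] := t'_min.
have [P_feas _] := P_opt; have iP := feasible_integrable P_feas.
have [[mP P0] P_temp PE] := P_feas.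
have b0 := ltW b_gt0.
have c_gt0 : 0 < c by rewrite divr_gt0 ?mulr_gt0 ?subr_gt0.
have /andP[t'0 t'D] : 0 <= t' <= D by move: t'0D; rewrite in_itv.
(* [cap t] is the value of [heat f t] at which the temperature is exactly [Tc], so the constraint
   becomes [heat f t <= cap t]. The increments of [cap] are the heat of the constant power [c],
   while [cap 0 = c / b] is positive because the start at [Te] lies below [Tc]. *)
pose heat (f : R -> R) (t : R) : R :=
  Rintegral lebesgue_measure `[0, t] (fun s => expR (b * s) * f s).
pose cap (t : R) : R := c / b * expR (b * t).
have heat_cap f t : lebesgue_measure.-integrable `[0, t] (EFin \o f) ->
    temperature a b Te f t = Tc + a * expR (- (b * t)) * (heat f t - cap t).
  move=> fi; rewrite temperatureE// -/(heat f t) mulrBr /cap expRN.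
  have e0 : expR (b * t) != 0 by rewrite gt_eqF ?expR_gt0.
  by rewrite /c; field; rewrite e0 !gt_eqF.
have sub s t : 0 <= s -> t <= D -> `[s, t] `<=` `[0, D].
  by move=> s0 tD; apply: subset_itv; rewrite bnd_simp.
have intS f s t : 0 <= s -> t <= D ->
    lebesgue_measure.-integrable `[0, D] (EFin \o f) ->
    lebesgue_measure.-integrable `[s, t] (EFin \o f).
  by move=> s0 tD; apply: integrableS => //; exact: sub.
have icst k : lebesgue_measure.-integrable `[0, D] (EFin \o cst k).
  apply: continuous_compact_integrable; first exact: segment_compact.
  by apply: continuous_subspaceT => x; exact: cst_continuous.
have heat_le f t : 0 <= t <= D ->
    lebesgue_measure.-integrable `[0, D] (EFin \o f) ->
    (temperature a b Te f t <= Tc) = (heat f t <= cap t).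
  move=> /andP[t0 tD] fi; rewrite heat_cap; last exact: intS.
  by rewrite gerDl pmulr_rle0 ?mulr_gt0 ?expR_gt0// subr_le0.
have heatP t : 0 <= t <= D -> heat P t <= cap t.
  by move=> t0D; rewrite -heat_le//; exact: P_temp.
have heatP_t' : heat P t' = cap t'.
  move: Tt'; rewrite heat_cap; last exact: intS.
  have ae_gt0 : 0 < a * expR (- (b * t')) by rewrite mulr_gt0 ?expR_gt0.
  move=> /eqP; rewrite -subr_eq0 addrAC subrr add0r mulf_eq0 (gt_eqF ae_gt0)/=.
  by rewrite subr_eq0 => /eqP.
have heat_cst s t : s <= t ->
    Rintegral lebesgue_measure `[s, t] (fun x => expR (b * x) * c) =
    cap t - cap s.
  move=> st; rewrite RintegralZr//; last first.
    apply: continuous_compact_integrable; first exact: segment_compact.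
    apply: continuous_subspaceT => x; apply: continuous_comp.
      exact: mulrl_continuous.
    exact: continuous_expR.
  by rewrite Rintegral_expR ?gt_eqF// /cap; ring.
(* [U] is the signed deficit of [P] with respect to [c] from [t'] on; [V] is the excess of [P] over
   [c] before [t']. *)
have [U defU] : exists U : R -> R,
    U = (fun t => c - P t) \_ `[t', +oo[ by eexists.
have [V defV] : exists V : R -> R,
    V = (fun t => Num.max (P t - c) 0) \_ `]-oo, t'[ by eexists.
have icP : lebesgue_measure.-integrable `[0, D] (EFin \o (fun t => c - P t)).
  by apply: (integrableB _ (icst c) iP).
have iU : lebesgue_measure.-integrable `[0, D] (EFin \o U).
  rewrite defU -restrict_EFin; apply/integrable_restrict => //.
  by apply: integrableS icP => //; exact: measurableI.
have iV : lebesgue_measure.-integrable `[0, D] (EFin \o V).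
  rewrite defV -restrict_EFin; apply/integrable_restrict => //.
  apply: (integrableS _ _ _ (integrable_funrpos _ (integrableB _ iP (icst c)))) => //.
  exact: measurableI.
have UE t : U t = if t' <= t then c - P t else 0 :> R.
  by rewrite defU patchE mem_setE in_itv/= andbT.
have VE t : V t = if t' <= t then 0 else Num.max (P t - c) 0 :> R.
  by rewrite defV patchE mem_setE in_itv/= ltNge; case: leP.
have V0 t : 0 <= V t by rewrite VE; case: ifP => // _; rewrite le_max lexx orbT.
have setI_t' s : `[0, s] `&` `[t', +oo[ = `[t', s]%classic :> set R.
  apply/seteqP; split => x; rewrite /= !in_itv/= andbT.
    by move=> [/andP[_ ->] ->].
  by move=> /andP[t'x ->]; rewrite t'x (le_trans t'0).
have heatP_itv s : t' <= s <= D ->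
    Rintegral lebesgue_measure `[t', s] (fun x => expR (b * x) * P x) =
    heat P s - heat P t'.
  move=> /andP[t's sD]; rewrite /heat (@Rintegral_itv_cat _ 0 t' s) ?t'0//.
    by rewrite addrC addKr.
  by apply: integrable_expR_mul => //; exact: intS iP.
have heatU s : t' <= s <= D ->
    heat U s = cap s - cap t' - (heat P s - heat P t').
  move=> /andP[t's sD]; rewrite -heatP_itv ?t's// -heat_cst//.
  rewrite -RintegralB//; last 2 first.
  - by apply: integrable_expR_mul => //; exact: intS (icst c).
  - by apply: integrable_expR_mul => //; exact: intS iP.
  rewrite -setI_t' Rintegral_mkcondr; apply: eq_Rintegral => x _.
  by rewrite defU !patchE; case: ifPn => _; rewrite ?mulr0// mulrBr.
pose d : R := Rintegral lebesgue_measure `[0, D] U.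
pose m : R := Rintegral lebesgue_measure `[0, D] V.
(* Since [heat P] equals [cap] at [t'] and never exceeds it, on each [[t', s]] the policy [P] brings
   at most the heat of the constant [c]. The weighted comparison carries this over to the energy. *)
have d_ge0 : 0 <= d.
  rewrite /d defU -Rintegral_mkcondr setI_t' RintegralB//;
    [|exact: intS (icst c)|exact: intS iP].
  rewrite subr_ge0; apply: (@le_Rintegral_of_expR_mul _ b) => //.
  - exact: intS iP.
  - exact: intS (icst c).
  - by move=> t /(sub _ _ t'0 (lexx D))/P0.
  - by move=> t _; exact: ltW.
  move=> s; rewrite in_itv/= => t'sD; rewrite heatP_itv// heatP_t'.
  have /andP[t's sD] := t'sD.
  by rewrite [leRHS]heat_cst// lerD2r heatP// (le_trans t'0).
have m_gt0 : 0 < m.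
  have mE : Rintegral lebesgue_measure `[0, t'] V <= m.
    rewrite /m (@Rintegral_itv_cat _ 0 t' D) ?t'0//.
    by apply: ler_wpDr => //; apply: Rintegral_ge0 => x _; exact: V0.
  have iPt' := integrable_expR_mul _ _ _ _ _ b0 (intS _ _ _ (lexx 0) t'D iP).
  have ict' := integrable_expR_mul _ _ _ _ _ b0
    (intS _ _ _ (lexx 0) t'D (icst c)).
  have iVt' : lebesgue_measure.-integrable `[0, t']
      (EFin \o (fun x => expR (b * t') * V x)).
    exact: (integrableZl _ _ (intS _ _ _ (lexx 0) t'D iV)).
  (* With [heat P t' = cap t'], this bound gives [cap 0 <= expR (b * t') * m], hence the positivity
     of [m]. *)
  have le_cap : heat P t' <= cap t' - cap 0 +
      expR (b * t') * Rintegral lebesgue_measure `[0, t'] V.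
    rewrite -heat_cst// -RintegralZl//; last exact: intS.
    rewrite -RintegralD// /heat.
    (* The endpoint is removed because [V] is 0 at [t'], where [P] may exceed [c] and the pointwise
       bound may fail. *)
    have sub_co : `[0, t'[ `<=` `[0, t'] by apply: subset_itvl; rewrite bnd_simp.
    rewrite -Rintegral_itv_bndo_bndc; last exact: integrableS iPt'.
    rewrite -[leRHS]Rintegral_itv_bndo_bndc; last first.
      by apply: integrableS (integrableD _ ict' iVt').
    apply: le_Rintegral => //.
    - exact: integrableS iPt'.
    - by apply: integrableS (integrableD _ ict' iVt').
    move=> x x0t'; have xt' : x < t' by move: x0t'; rewrite /= in_itv/= => /andP[].
    rewrite VE (leNgt t') xt'/= -lerBlDl -mulrBr.
    apply: (@le_trans _ _ (expR (b * x) * Num.max (P x - c) 0)).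
      by rewrite ler_wpM2l ?expR_ge0// le_max lexx.
    by rewrite ler_wpM2r ?le_max ?lexx ?orbT// ler_expR ler_wpM2l// ltW.
  have cap0 : 0 < cap 0 by rewrite mulr_gt0 ?expR_gt0// divr_gt0.
  rewrite -(pmulr_rgt0 _ (expR_gt0 (b * t'))).
  apply: lt_le_trans (ler_wpM2l (expR_ge0 _) mE).
  by move: le_cap; rewrite heatP_t'; lra.
(* The fractions m / (m + d) and d / (m + d) balance the energy added after [t'] with the energy
   withdrawn before. The first is positive because [m] is; the second may be 0. *)
have [theta [kappa [theta01 kappa01 tdkm]]] : exists theta kappa : R,
    [/\ 0 < theta <= 1, 0 <= kappa <= 1 & theta * d = kappa * m].
  have md_gt0 : 0 < m + d by rewrite ltr_wpDr.
  exists (m / (m + d)), (d / (m + d)); split;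
    last by rewrite mulrAC [RHS]mulrAC (mulrC m).
    by rewrite divr_gt0//= ler_pdivrMr// mul1r lerDl.
  by rewrite divr_ge0 ?(ltW md_gt0)//= ler_pdivrMr// mul1r lerDr ltW.
(* [w] is the fraction of the way from [P] to [c] that [Q] moves; it is 0 before [t'] wherever [P]
   is at most [c]. *)
pose Q (t : R) : R := P t + theta * U t - kappa * V t.
pose w (t : R) : R := if t' <= t then theta else if c < P t then kappa else 0.
have Qw t : 0 <= w t <= 1 /\ Q t = P t + w t * (c - P t).
  rewrite /w /Q UE VE; case: (t' <= t) => /=.
    by have /andP[/ltW-> ->] := theta01; rewrite mulr0 subr0.
  case: ltP => Pc.
    by rewrite kappa01 max_l ?subr_ge0 ?(ltW Pc)//; split => //; ring.
  by rewrite lexx ler01 max_r ?subr_le0//; split => //; ring.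
have iPU : lebesgue_measure.-integrable `[0, D]
    (EFin \o (fun t => P t + theta * U t)).
  by apply: (integrableD _ iP (integrableZl _ theta iU)).
have iQ : lebesgue_measure.-integrable `[0, D] (EFin \o Q).
  by apply: (integrableB _ iPU (integrableZl _ kappa iV)).
have Q_energy : Rintegral lebesgue_measure `[0, D] Q =
    Rintegral lebesgue_measure `[0, D] P.
  rewrite RintegralB//; last exact: (integrableZl _ kappa iV).
  rewrite RintegralD//; last exact: (integrableZl _ theta iU).
  by rewrite !RintegralZl// -/d -/m tdkm addrK.
have Q_feas : feasible D E a b Te Tc Q.
  split; first split.
  - by apply/measurable_EFinP; exact: measurable_int iQ.
  - move=> t t0D; have [/andP[w0 w1] ->] := Qw t; have Pt := P0 t t0D.
    have -> : P t + w t * (c - P t) = (1 - w t) * P t + w t * c by ring.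
    by rewrite addr_ge0// mulr_ge0 ?subr_ge0// ltW.
  - move=> t; rewrite in_itv => /= /andP[t0 tD].
    rewrite heat_le ?t0//.
    have iexp f := fun fi => integrable_expR_mul _ _ _ _ f b0
      (intS f _ _ (lexx 0) tD fi).
    (* Before [t'] the new policy only lowers the power, so its heat is at most that of [P]. *)
    have [tt'|t't] := ltP t t'.
      apply: le_trans (heatP t _); last by rewrite t0.
      apply: le_Rintegral; [by []|exact: iexp|exact: iexp|].
      move=> x x0t; have xt : x <= t by move: x0t; rewrite /= in_itv/= => /andP[].
      rewrite ler_wpM2l ?expR_ge0// /Q UE (leNgt t') (le_lt_trans xt tt')/=.
      by rewrite mulr0 addr0 gerBl mulr_ge0//; case/andP: kappa01.
    (* From [t'] on, the heat saved through [V] is discarded. As [heat P t' = cap t'], the rest is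
       the convex combination of [heat P t] and [cap t] with weights [1 - theta] and [theta]. *)
    apply: (@le_trans _ _ (heat P t + theta * heat U t)).
      rewrite -RintegralZl//; last exact: iexp.
      rewrite -RintegralD//; last 2 first.
      - exact: iexp.
      - by apply: (integrableZl _ theta (iexp _ iU)).
      apply: le_Rintegral; [by []|exact: iexp| |].
        by apply: (integrableD _ (iexp _ iP) (integrableZl _ theta (iexp _ iU))).
      move=> x _; rewrite mulrCA -mulrDr ler_wpM2l ?expR_ge0// gerBl mulr_ge0//.
      by case/andP: kappa01.
    have := heatP t; rewrite t0 => /(_ tD) heatPt.
    rewrite heatU ?t't// heatP_t'.
    have -> : heat P t + theta * (cap t - cap t' - (heat P t - cap t')) =
              cap t - (1 - theta) * (cap t - heat P t) by ring.
    by rewrite gerBl mulr_ge0 ?subr_ge0//; case/andP: theta01.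
  - rewrite /energy -(fineK (integrable_fin_num _ iQ))//.
    rewrite (_ : fine _ = Rintegral lebesgue_measure `[0, D] Q)// Q_energy.
    by rewrite /Rintegral (fineK (integrable_fin_num _ iP)).
have Q_ge : Rintegral lebesgue_measure `[0, D] P <=
    Rintegral lebesgue_measure `[0, D] Q by rewrite Q_energy.
have := optimal_policy_ae_eq _ _ _ _ _ _ _ _ _ _ _ (ltW c_gt0) P_opt Q_feas
  (fun t _ => Qw t) Q_ge.
apply: (@filterS _ _ (ae_filter_ringOfSetsType lebesgue_measure)) => t Pc.
rewrite in_itv/= => /andP[t't tD]; apply: Pc.
  by rewrite in_itv/= tD (le_trans t'0).
by rewrite /w t't; case/andP: theta01.
Qed.
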